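(* For every undirected edge-capacitated graph $G=(V,E)$ with capacities $c$ and every terminal set $K\subseteq V$ with $|K|=k$, there is an $O(\log k)$-oblivious routing scheme for $K$-flows in $G$.
   Context: A $K$-flow is a multicommodity flow all of whose sources and sinks lie in $K$. An oblivious routing scheme for $K$-flows specifies, for each pair of terminals $s,t\in K$, a fixed unit flow from $s$ to $t$ in $G$ (independent of the demands); given demands $D:K\times K\to\mathbb{R}_{\ge0}$, each demand $D(s,t)$ is routed by scaling the corresponding unit flow by $D(s,t)$. The congestion of a routing is the maximum over edges $e$ of the total flow on $e$ divided by $c(e)$. The scheme is $\alpha$-oblivious if for every demand $D$ on $K\times K$ the congestion of the oblivious routing of $D$ is at most $\alpha$ times the minimum congestion over all multicommodity flows in $G$ routing $D$. The $O(\cdot)$ hides an absolute constant, for $k\ge2$. *)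

(* Defs.v *)
From HB Require Import structures.
From mathcomp Require Import all_boot all_order all_algebra.
From mathcomp Require Import classical_sets reals ereal constructive_ereal exp.

Set Implicit Arguments.
Unset Strict Implicit.
Unset Printing Implicit Defensive.

Import Order.TTheory GRing.Theory Num.Theory.
Local Open Scope classical_set_scope.
Local Open Scope ring_scope.

(* The values of [cap] on non-adjacent pairs are never used. *)
Record capGraph (R : realType) := CapGraph {
  vertex :> finType;
  adj : rel vertex;
  cap : vertex -> vertex -> R;
  adj_sym : symmetric adj;
  adj_irr : irreflexive adj;
  cap_sym : forall u v, cap u v = cap v u;
  cap_gt0 : forall u v, adj u v -> 0 < cap u v
}.

(* [f u v] is the net amount of flow sent from [u] to [v] along the undirected
   edge {u, v}, so the amount of flow on that edge is [`|f u v|]. For [s = t]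
   the last clause says that [f] is a circulation. *)
Definition is_flow (R : realType) (G : capGraph R) (s t : G) (d : R)
    (f : G -> G -> R) : Prop :=
  [/\ forall u v, f u v = - f v u,
      forall u v, ~~ adj u v -> f u v = 0
    & forall v, \sum_(w : G) f v w = d *+ (v == s) - d *+ (v == t)].

(* A family of flows [g], with [g s t] the flow of the commodity with source
   [s] and sink [t]; only the commodities in K x K are ever considered. *)
Definition multiflow (R : realType) (G : capGraph R) :=
  G -> G -> (G -> G -> R).

Definition routes (R : realType) (G : capGraph R) (K : {set G})
    (D : G -> G -> R) (g : multiflow G) : Prop :=
  forall s t, s \in K -> t \in K -> is_flow s t (D s t) (g s t).

Definition total_flow (R : realType) (G : capGraph R) (K : {set G})
    (g : multiflow G) (u v : G) : R :=
  \sum_(s in K) \sum_(t in K) `|g s t u v|.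

Definition congestion (R : realType) (G : capGraph R) (K : {set G})
    (g : multiflow G) : R :=
  \big[Num.max/0]_(e : G * G | adj e.1 e.2)
    (total_flow K g e.1 e.2 / cap e.1 e.2).

(* Equal to +oo when no multicommodity flow routes [D], i.e. when [D] has a
   positive demand between different connected components. *)
Definition min_congestion (R : realType) (G : capGraph R) (K : {set G})
    (D : G -> G -> R) : \bar R :=
  ereal_inf [set (congestion K g)%:E | g in [set g | routes K D g]].

(* No unit flow joins terminals in different connected components, so none is
   required there; when G is connected this is a unit flow for every pair. *)
Definition routing_scheme (R : realType) (G : capGraph R) (K : {set G})
    (f : multiflow G) : Prop :=
  forall s t, s \in K -> t \in K -> connect (@adj R G) s t ->
    is_flow s t 1 (f s t).

Definition oblivious_routing (R : realType) (G : capGraph R)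
    (f : multiflow G) (D : G -> G -> R) : multiflow G :=
  fun s t u v => D s t * f s t u v.

Definition oblivious (R : realType) (G : capGraph R) (alpha : R)
    (K : {set G}) (f : multiflow G) : Prop :=
  routing_scheme K f /\
  forall D : G -> G -> R,
    (forall s t, s \in K -> t \in K -> 0 <= D s t) ->
    ((congestion K (oblivious_routing f D))%:E
       <= alpha%:E * min_congestion K D)%E.

(* Main.v *)
(* By a multiplicative-weights minimax argument it suffices, for every choice of
   positive edge lengths, to find a routing whose worst-case load, summed over
   the edges against the lengths, is O(log k) times the total volume (capacity
   times length). Such a routing is built from random partitions: for a random
   order of the terminals and dyadic radii rho_j in [2^(j-1), 2^j), a vertex is
   mapped at level j to the first terminal within distance rho_j, and a terminal
   s is routed along shortest paths through its images at levels 0, 1, 2, ...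
   Two terminals in one component end at the same image, which joins their
   routes. The hop from a at level j to b at level j + 1 only carries demand
   separated by the set S of vertices with these two images, which is at most the
   capacity of the boundary of S if the demand is routable with congestion 1;
   the levels need not form a laminar family. An edge of length l is separated
   at radius r with a probability whose sum over all r is at most
   l * (1 + 1/2 + ... + 1/k), because the j-th closest terminal to the edge can
   be responsible only for at most l radii, and only if it precedes the j - 1
   closer ones. *)

Require Import Defs.
From HB Require Import structures.
From mathcomp Require Import all_boot all_order all_algebra.
From mathcomp Require Import all_fingroup zify ring lra.
From mathcomp Require Import boolp classical_sets reals ereal constructive_ereal sequences exp.
From mathcomp Require Import fintype finset.

Set Implicit Arguments.
Unset Strict Implicit.
Unset Printing Implicit Defensive.

Import Order.TTheory GRing.Theory Num.Theory.
Local Open Scope ring_scope.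

(** * Approximate minimax by multiplicative weights *)

(** Follows from [1 - y / 2 <= expR (- (y / 2))] and [1 <= (1 + y) * (1 - y / 2)] on [0, 1]. *)
Lemma expR_half_le1D (R : realType) (y : R) :
  0 <= y -> y <= 1 -> expR (y / 2) <= 1 + y.
Proof.
move=> y0 y1.
have h1 : 1 - y / 2 <= expR (- (y / 2)) by apply: expR_ge1Dx.
rewrite expRN in h1.
have h2 : 0 < expR (y / 2) by apply: expR_gt0.
have h3 : (1 - y / 2) * expR (y / 2) <= 1.
  by rewrite -ler_pdivlMr // div1r.
nra.
Qed.

Section Minimax.
(** [Q s x] abstracts [routable]: [s] units can be routed with relative loads [x]. Such pairs form a
    convex cone. *)
Variables (R : realType) (E : finType) (Q : R -> (E -> R) -> Prop) (alpha : R).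
Hypothesis alpha_gt0 : 0 < alpha.
Hypothesis Q0 : Q 0 (fun=> 0).
Hypothesis QD : forall s t x y, Q s x -> Q t y -> Q (s + t) (fun e => x e + y e).
Hypothesis QZ : forall a s x, 0 <= a -> Q s x -> Q (a * s) (fun e => a * x e).
Hypothesis oracle : forall w : E -> R, (forall e, 0 < w e) ->
  exists x, [/\ Q 1 x, forall e, 0 <= x e
    & \sum_e w e * x e <= alpha * \sum_e w e].

(* The weight of [e] is [expR (S e / 2)]. Steps are normalised so that the
   increments of [S] sum to 1, hence no bound on the entries of [x] is needed. *)
Lemma multiplicative_weights (N : nat) :
  (exists2 x, Q 1 x & forall e, x e <= 0) \/
  exists s S, [/\ 0 <= s, Q s S, \sum_e S e = N%:R
    & \sum_e expR (S e / 2) <= #|E|%:R * expR (alpha * s)].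
Proof.
elim: N => [|N [|[s [S [s0 QS sumS pot]]]]]; [right|by left|].
  exists 0, (fun=> 0); split => //; first by rewrite big1.
  rewrite mulr0 mul0r expR0 mulr1.
  by rewrite (eq_bigr (fun=> 1)) ?sumr_const // => e _; rewrite mul0r expR0.
have [|x [Qx x0 wx]] := oracle (w := fun e => expR (S e / 2)).
  by move=> e; apply: expR_gt0.
have X0 : 0 <= \sum_e x e by apply: sumr_ge0.
have xX e : x e <= \sum_e x e by rewrite (bigD1 e) //= lerDl sumr_ge0.
move: X0; rewrite le_eqVlt => /orP[/eqP X0|Xgt].
  by left; exists x => // e; rewrite X0.
right; set d := (\sum_e x e)^-1.
have d0 : 0 < d by rewrite invr_gt0.
exists (s + d * 1), (fun e => S e + d * x e); split.
- by rewrite mulr1 addr_ge0 // ltW.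
- by apply: QD => //; apply: QZ => //; apply: ltW.
- by rewrite big_split /= sumS -mulr_sumr mulVf ?gt_eqF // -natr1.
apply: (@le_trans _ _ (\sum_e expR (S e / 2) * (1 + d * x e))).
  apply: ler_sum => e _; rewrite mulrDl expRD ler_wpM2l ?expR_ge0 //.
  apply: expR_half_le1D; first by rewrite mulr_ge0 // ltW.
  by rewrite mulrC ler_pdivrMr // mul1r.
(* The oracle was queried with the current weights, so one step multiplies the potential by at most
   [1 + alpha * d]. *)
apply: (@le_trans _ _ ((1 + alpha * d) * \sum_e expR (S e / 2))).
  rewrite mulrDl mul1r.
  rewrite (eq_bigr (fun e => expR (S e / 2) + d * (expR (S e / 2) * x e))); last first.
    by move=> e _; ring.
  rewrite big_split /= lerD2l -mulr_sumr mulrAC mulrC -[X in _ <= X]mulrC.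
  by rewrite mulrC ler_wpM2l // ltW.
apply: (@le_trans _ _ (expR (alpha * d) * (#|E|%:R * expR (alpha * s)))).
  apply: ler_pM => //; last exact: expR_ge1Dx.
    by rewrite addr_ge0 // mulr_ge0 // ltW.
  by apply: sumr_ge0 => e _; apply: expR_ge0.
by rewrite mulr1 mulrDr expRD mulrCA [expR (alpha * d) * _]mulrC.
Qed.

(** The potential gives [S e <= 2 * (ln m + alpha * s)] for every [e]. As the entries of [S] sum to
    [N], taking [N > 4 * m * ln m] forces [ln m < alpha * s]. Hence [S e <= 4 * alpha * s], and
    division by [s] normalises. *)
Lemma approx_minimax : exists2 x, Q 1 x & forall e, x e <= 4 * alpha.
Proof.
have [e0 _|E0] := pickP (mem E); last first.
  have [|x [Qx _ _]] := oracle (w := fun=> 1); first by move=> e; rewrite ltr01.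
  by exists x => // e; have := E0 e.
set m : R := #|E|%:R.
have m1 : 1 <= m by rewrite ler1n; apply/card_gt0P; exists e0.
have m0 : 0 < m by apply: lt_le_trans m1.
have lm0 : 0 <= ln m by apply: ln_ge0.
have [N hN] : exists N : nat, 4 * m * ln m < N%:R.
  exists (Num.trunc (4 * m * ln m)).+1; exact: Num.Theory.truncnS_gt.
case: (multiplicative_weights N) => [[x Qx x0]|[s [S [s0 QS sumS pot]]]].
  by exists x => // e; apply: le_trans (x0 e) _; rewrite mulr_ge0 // ltW.
have Sle e : S e <= 2 * (ln m + alpha * s).
  have h : expR (S e / 2) <= m * expR (alpha * s).
    apply: le_trans pot; rewrite (bigD1 e) //= lerDl.
    by apply: sumr_ge0 => ? _; apply: expR_ge0.
  have : S e / 2 <= ln m + alpha * s.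
    by rewrite -ler_expR expRD lnK // posrE.
  lra.
have hNs : N%:R <= m * (2 * (ln m + alpha * s)).
  rewrite -sumS; apply: le_trans (ler_sum _ (fun e _ => Sle e)) _.
  by rewrite sumr_const -[X in X <= _]mulr_natl.
have lms : ln m < alpha * s.
  have : 0 < 2 * m * (alpha * s - ln m) by lra.
  by rewrite pmulr_rgt0 ?subr_gt0 // mulr_gt0.
have sgt : 0 < s by rewrite -(pmulr_rgt0 _ alpha_gt0) (le_lt_trans lm0).
exists (fun e => s^-1 * S e).
  by rewrite -(@mulVf _ s) ?gt_eqF //; apply: QZ => //; rewrite invr_ge0.
move=> e; rewrite mulrC ler_pdivrMr //; apply: le_trans (Sle e) _; lra.
Qed.

End Minimax.

(** * Separation by a random order *)

(* If [m] is injective on [A], this is the bound [1 + ln n] on the [n]-th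
   harmonic number; ties only decrease the sum. *)
Lemma sum_inv_card_le_ln (R : realType) (T : finType) (m : T -> nat) (A : {set T}) :
  \sum_(t in A) (#|[set s in A | (m s <= m t)%N]|%:R^-1 : R) <= 1 + ln #|A|%:R.
Proof.
have [n] := ubnP #|A|; elim: n A => // n IHn A; rewrite ltnS => An.
have [->|[a0 a0A]] := set_0Vmem A.
  by rewrite big_set0 cards0 addr_ge0 // ln0.
(* Removing an element with the largest [m] removes the term [1 / #|A|] and increases no cardinality
   in the other terms. *)
have [a aA amax] := arg_maxnP m a0A; have {}aA : a \in A := aA.
have Ua : [set s in A | (m s <= m a)%N] = A.
  by apply/setP => s; rewrite inE andb_idr // => /amax.
rewrite (big_setD1 a) //= Ua.
set k := #|A :\ a|; have cA : #|A| = k.+1 by rewrite (cardsD1 a A) aA.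
have k1 : (0 < (k.+1%:R : R)) by rewrite ltr0n.
have : \sum_(t in A :\ a) (#|[set s in A | (m s <= m t)%N]|%:R^-1 : R) <=
       \sum_(t in A :\ a) (#|[set s in A :\ a | (m s <= m t)%N]|%:R^-1 : R).
  apply: ler_sum => t tA; rewrite lef_pV2 ?posrE ?ltr0n ?card_gt0.
  - by rewrite ler_nat subset_leq_card //; apply/subsetP => s; rewrite !inE => /andP[/andP[_ ->] ->].
  - by apply/set0Pn; exists t; move: tA; rewrite !inE => /andP[_ ->]/=.
  - by apply/set0Pn; exists t; rewrite inE tA /=.
move=> /le_trans/(_ (IHn _ _)); rewrite -/k -[(k < n)%N]/(k.+1 <= n)%N -cA.
move=> /(_ An) IH; rewrite cA.
(* For a singleton the induction hypothesis only bounds the remaining sum by [1 + ln 0 = 1], which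
   is too weak; that sum is empty. *)
have [k0|kgt] := posnP k.
  move: IH; have -> : A :\ a = set0 by apply/eqP; rewrite -cards_eq0 -/k k0.
  by rewrite big_set0 k0 invr1 ln1 !addr0.
suff : (k.+1%:R^-1 : R) <= ln k.+1%:R - ln k%:R.
  by move=> h; apply: le_trans (lerD h IH) _; lra.
have kR : 0 < (k%:R : R) by rewrite ltr0n.
have e1 : ln (k%:R : R) = ln k.+1%:R + ln (1 + - k.+1%:R^-1).
  rewrite -lnM ?posrE //; last first.
    by rewrite subr_gt0 invf_lt1 // ltr1n ltnS.
  congr ln; rewrite mulrDr mulr1 mulrN divff ?gt_eqF //.
  by rewrite -natr1 addrK.
rewrite e1 opprD addrA subrr add0r lerNr.
by apply: le_ln1Dx; rewrite ltrN2 invf_lt1 // ltr1n ltnS.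
Qed.

Section RandomOrder.
Variable T : finType.
Implicit Types (pi : {perm T}) (X : {set T}).

(** [pi] encodes the order in which [t] has the rank of [pi t], so a uniform permutation is a
    uniform random order. *)
Definition is_first pi X t :=
  (t \in X) && [forall s in X, (enum_rank (pi t) <= enum_rank (pi s))%N].

Definition first pi X : option T := [pick t | is_first pi X t].

Lemma is_first_inj pi X s t : is_first pi X s -> is_first pi X t -> s = t.
Proof.
move=> /andP[sX /forall_inP sm] /andP[tX /forall_inP tm].
apply: (@perm_inj _ pi); apply: enum_rank_inj; apply/val_inj/eqP.
by rewrite eqn_leq sm // tm.
Qed.

Lemma exists_is_first pi X x : x \in X -> exists t, is_first pi X t.
Proof.
move=> xX.
have [t tX tm] := arg_minnP (fun t => enum_rank (pi t) : nat) xX.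
by exists t; apply/andP; split; [exact: tX|apply/forall_inP].
Qed.

Lemma firstE pi X t : (first pi X == Some t) = is_first pi X t.
Proof.
rewrite /first; case: pickP => [s sf|nf]; last by rewrite nf.
apply/eqP/idP => [[<-]//|/(is_first_inj sf)->//].
Qed.

Lemma card_set_sum (I : finType) (P : pred I) : #|[set i | P i]| = (\sum_i P i)%N.
Proof.
by rewrite -sum1_card big_mkcond; apply: eq_bigr => i _; rewrite inE; case: (P i).
Qed.

(** Composition with [tperm t s] exchanges the orders in which [s] is first with those in which [t]
    is, and every order has exactly one first element of [X]. *)
Lemma card_is_first X t : t \in X ->
  (#|[set pi | is_first pi X t]| * #|X|)%N = #|{perm T}|.
Proof.
move=> tX.
have same s : s \in X -> #|[set pi | is_first pi X s]| = #|[set pi | is_first pi X t]|.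
  move=> sX.
  have XX x : (tperm t s x \in X) = (x \in X) by case: tpermP => // ->; rewrite sX tX.
  rewrite -(card_imset _ (mulgI (tperm t s))); apply: eq_card => pi.
  have -> : (pi \in [set (tperm t s * x)%g | x in [set pi | is_first pi X s]]) =
            is_first (tperm t s * pi)%g X s.
    apply/imsetP/idP => [[pi' ]|H].
      by rewrite inE => H ->; rewrite mulgA tperm2 mul1g.
    by exists (tperm t s * pi)%g; rewrite ?inE // mulgA tperm2 mul1g.
  rewrite inE /is_first sX tX /= permM tpermR.
  apply/forall_inP/forall_inP => H x xX.
    by have := H (tperm t s x); rewrite XX => /(_ xX); rewrite permM tpermK.
  by rewrite permM; apply: H; rewrite XX.
rewrite mulnC -sum_nat_const -(eq_bigr _ same).
rewrite (eq_bigr (fun s => \sum_pi is_first pi X s)%N); last by move=> s _; apply: card_set_sum.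
rewrite exchange_big -sum1_card /=; apply: eq_bigr => pi _.
have [s sf] := exists_is_first pi tX.
rewrite (bigD1 s) /=; last by case/andP: sf.
rewrite sf big1 ?addn0 // => u /andP[_ us].
by apply/eqP; rewrite eqb0; apply: contra us => /(is_first_inj sf) ->.
Qed.

(** If the first element of the union lay in both sets, it would be first in each of them. *)
Lemma first_neq pi X Y : first pi X != first pi Y ->
  exists2 t, is_first pi (X :|: Y) t & (t \in X) != (t \in Y).
Proof.
move=> neq.
have [U0|[x xXY]] := set_0Vmem (X :|: Y).
  move/eqP: U0; rewrite setU_eq0 => /andP[/eqP X0 /eqP Y0].
  by rewrite X0 Y0 eqxx in neq.
have [t tf] := exists_is_first pi xXY; exists t => //.
move: tf => /andP[]; rewrite inE => tXY /forall_inP tm.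
apply: contraNneq neq => e; have : (t \in X) && (t \in Y) by rewrite e in tXY *; rewrite orbb in tXY; rewrite tXY.
case/andP=> tX tY.
have /eqP -> : first pi X == Some t.
  by rewrite firstE /is_first tX; apply/forall_inP => s sX; rewrite tm // inE sX.
rewrite eq_sym firstE /is_first tY; apply/forall_inP => s sX.
by rewrite tm // inE sX orbT.
Qed.

(** Meant for an edge of length [l], with [p] and [q] the distances from the terminals to its ends.
    Separation at radius [r] needs a terminal [t] within [r] of exactly one end that precedes all of
    [U t], the terminals at least as close. The former holds for at most [l] radii, the latter with
    probability [1 / #|U t|], and these inverses have a harmonic sum. *)
Lemma sum_first_neq_le (R : realType) (A : {set T}) (p q : T -> nat) (l N : nat) :
  (forall t, t \in A -> p t <= q t + l)%N -> (forall t, t \in A -> q t <= p t + l)%N ->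
  \sum_pi \sum_(r < N) ((first pi [set t in A | (p t <= r)%N] !=
     first pi [set t in A | (q t <= r)%N])%:R : R)
  <= #|{perm T}|%:R * (1 + ln #|A|%:R) * l%:R.
Proof.
move=> pq qp.
pose m t := minn (p t) (q t).
pose U t := [set s in A | (m s <= m t)%N].
pose cut t r := (p t <= r)%N != (q t <= r)%N.
have step pi (r : 'I_N) :
  ((first pi [set t in A | (p t <= r)%N] != first pi [set t in A | (q t <= r)%N])%:R : R)
  <= \sum_(t in A) (is_first pi (U t) t)%:R * (cut t r)%:R.
  case: eqP => [_|/eqP /first_neq[t tf tc]]; first by apply: sumr_ge0 => t _; rewrite mulr_ge0.
  have tA : t \in A by move: tf => /andP[]; rewrite !inE -andb_orr => /andP[].
  have mr : (m t <= r)%N by move: tf => /andP[]; rewrite !inE tA geq_min.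
  rewrite (bigD1 t) //=; have -> : is_first pi (U t) t.
    rewrite /is_first inE tA leqnn; apply/forall_inP => s; rewrite inE => /andP[sA st].
    move: tf => /andP[_ /forall_inP]; apply; rewrite !inE sA /= -geq_min.
    exact: leq_trans st mr.
  have -> : cut t r by move: tc; rewrite !inE tA.
  by rewrite mulr1 lerDl; apply: sumr_ge0 => s _; rewrite mulr_ge0.
apply: le_trans (ler_sum _ (fun pi _ => ler_sum _ (fun r _ => step pi r))) _.
have cutl t : t \in A -> \sum_(r < N) ((cut t r)%:R : R) <= l%:R.
  move=> tA; rewrite -natr_sum ler_nat.
  (* The radii that cut [t] run from [minn (p t) (q t)] up to, but excluding, [maxn (p t) (q t)]. *)
  have h : (\sum_(r < N) cut t r <= minn N (maxn (p t) (q t)) - minn (p t) (q t))%N.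
    elim: (N) => [|n IHn]; first by rewrite big_ord0.
    rewrite big_ord_recr /= /cut; move: IHn; rewrite /cut.
    by case: (leqP (p t) n); case: (leqP (q t) n) => /=; lia.
  by apply: leq_trans h _; have := pq t tA; have := qp t tA; lia.
have -> : \sum_pi \sum_(r < N) \sum_(t in A)
    ((is_first pi (U t) t)%:R * (cut t r)%:R : R)
  = \sum_(t in A) (\sum_pi (is_first pi (U t) t)%:R) * \sum_(r < N) (cut t r)%:R.
  rewrite (eq_bigr (fun pi => \sum_(t in A) \sum_(r < N)
     ((is_first pi (U t) t)%:R * (cut t r)%:R : R))); last by move=> pi _; apply: exchange_big.
  rewrite exchange_big; apply: eq_bigr => t _ /=.
  by rewrite mulr_suml; apply: eq_bigr => pi _; rewrite mulr_sumr.
apply: (@le_trans _ _ (\sum_(t in A) (#|{perm T}|%:R * #|U t|%:R^-1) * l%:R)).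
  apply: ler_sum => t tA.
  have Ut : t \in U t by rewrite inE tA leqnn.
  have U0 : 0 < (#|U t|%:R : R) by rewrite ltr0n card_gt0; apply/set0Pn; exists t.
  have -> : \sum_pi (is_first pi (U t) t)%:R = #|{perm T}|%:R / #|U t|%:R :> R.
    by rewrite -(card_is_first Ut) natrM mulfK ?gt_eqF // -natr_sum -card_set_sum.
  by apply: (ler_wpM2l _ (cutl t tA)); rewrite divr_ge0.
rewrite -mulr_suml -mulr_sumr ler_wpM2r // ler_wpM2l //.
exact: sum_inv_card_le_ln.
Qed.

End RandomOrder.

(** * Shortest paths and path flows *)

Section Distance.
Variables (T : finType) (adj : rel T) (len : T -> T -> nat).
Hypothesis adj_sym : symmetric adj.
Hypothesis len_sym : forall u v, len u v = len v u.
Hypothesis len_gt0 : forall u v, adj u v -> (0 < len u v)%N.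

Fixpoint path_len (x : T) (p : seq T) : nat :=
  if p is y :: p' then (len x y + path_len y p')%N else 0%N.

Lemma path_len_cat x p q :
  path_len x (p ++ q) = (path_len x p + path_len (last x p) q)%N.
Proof. by elim: p x => //= y p IHp x; rewrite IHp addnA. Qed.

Definition reach_within x y n :=
  `[< exists p, [/\ path adj x p, last x p = y & (path_len x p <= n)%N] >].

Lemma reach_withinP x y : connect adj x y -> exists n, reach_within x y n.
Proof.
move=> /connectP[p xp ->]; exists (path_len x p); apply/asboolP.
by exists p.
Qed.

(* Junk value 0 when [x] and [y] are not connected. *)
Definition dist x y : nat :=
  if pselect (connect adj x y) is left c then ex_minn (reach_withinP c) else 0%N.

Lemma dist_path x y : connect adj x y ->
  exists p, [/\ path adj x p, last x p = y & path_len x p = dist x y].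
Proof.
rewrite /dist; case: pselect => // c _; case: ex_minnP => n /asboolP[p [xp py pn]] nmin.
exists p; split => //; apply/eqP; rewrite eqn_leq pn nmin //.
by apply/asboolP; exists p.
Qed.

Lemma dist_le_path x p : path adj x p -> (dist x (last x p) <= path_len x p)%N.
Proof.
move=> xp; rewrite /dist; case: pselect => // c; case: ex_minnP => n _; apply.
by apply/asboolP; exists p.
Qed.

Lemma dist0 x : dist x x = 0%N.
Proof. by apply/eqP; rewrite -leqn0; apply: (@dist_le_path x [::]). Qed.

Lemma dist_eq0 x y : connect adj x y -> dist x y = 0%N -> x = y.
Proof.
move=> /dist_path[[|z p] [/= xp <- <-]] // /eqP.
by rewrite addn_eq0 => /andP[/eqP l0 _]; case/andP: xp => /len_gt0; rewrite l0.
Qed.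

Lemma dist_triangle x y z : connect adj x y -> connect adj y z ->
  (dist x z <= dist x y + dist y z)%N.
Proof.
move=> /dist_path[p [xp py <-]] /dist_path[q [yq qz <-]]; subst y z.
by rewrite -path_len_cat -last_cat; apply: dist_le_path; rewrite cat_path xp.
Qed.

Lemma dist_sym x y : dist x y = dist y x.
Proof.
have csym : connect_sym adj by apply: sym_connect_sym.
suff le_dist x' y' : connect adj x' y' -> (dist y' x' <= dist x' y')%N.
  have [c|nc] := boolP (connect adj x y); last first.
    by rewrite /dist; case: pselect => [c|_]; rewrite ?c // in nc *; case: pselect => // c; rewrite csym c in nc.
  by apply/eqP; rewrite eqn_leq !le_dist // csym.
move=> /dist_path[p [xp py <-]].
have -> : path_len x' p = path_len y' (rev (belast x' p)).
  rewrite -py; elim: p x' {xp py} => //= z p IHp x'.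
  rewrite rev_cons -cats1 path_len_cat -IHp addnC; congr addn.
  rewrite /= addn0 len_sym; congr len.
  by case: (lastP p) => // p' z'; rewrite belast_rcons rev_cons last_rcons.
have lastq : last y' (rev (belast x' p)) = x'.
  by rewrite -py; case: p {xp py} => //= z p; rewrite rev_cons last_rcons.
rewrite -{1}lastq; apply: dist_le_path; rewrite -py rev_path.
by rewrite (eq_path (e' := adj)) // => a b; rewrite adj_sym.
Qed.

Lemma dist_adj x u v : adj u v -> (dist x v <= dist x u + len u v)%N.
Proof.
(* If [x] does not reach [u], it does not reach [v] either, and the left side is the default value
   0. *)
move=> uv; have [c|nc] := boolP (connect adj x u); last first.
  suff nc' : ~~ connect adj x v by rewrite /dist; case: pselect => // c; rewrite c in nc'.
  apply: contra nc => /connect_trans; apply; apply: connect1; by rewrite adj_sym.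
apply: leq_trans (dist_triangle c (connect1 uv)) _; rewrite leq_add2l.
by have := @dist_le_path u [:: v]; rewrite /= addn0 andbT; apply.
Qed.

End Distance.

Section PathFlow.
Variables (R : realType) (G : capGraph R).

Definition edge_flow (x y : G) : G -> G -> R := fun u v =>
  ((u == x) && (v == y))%:R - ((u == y) && (v == x))%:R.

Fixpoint path_flow (x : G) (p : seq G) : G -> G -> R :=
  if p is y :: p' then fun u v => edge_flow x y u v + path_flow y p' u v
  else fun _ _ => 0.

Lemma path_flow_is_flow x p : path (@adj R G) x p ->
  is_flow x (last x p) 1 (path_flow x p).
Proof.
elim: p x => [|y p IHp] x /=.
  by move=> _; split=> // [u v|v]; rewrite ?oppr0 ?subrr ?big1.
move=> /andP[xy yp]; have [Fs Fa Fd] := IHp _ yp; split.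
- by move=> u v; rewrite Fs /edge_flow opprD opprB [_ && (v == y)]andbC [_ && (v == x)]andbC.
- move=> u v nuv; rewrite Fa // addr0 /edge_flow.
  have -> : (u == x) && (v == y) = false by apply: contraNF nuv => /andP[/eqP -> /eqP ->].
  have -> : (u == y) && (v == x) = false.
    by apply: contraNF nuv => /andP[/eqP -> /eqP ->]; rewrite adj_sym.
  by rewrite subrr.
- have sum1 (a b v : G) : \sum_w (((v == a) && (w == b))%:R : R) = (v == a)%:R.
    by rewrite (bigD1 b) //= eqxx andbT big1 ?addr0 // => w /negPf ->; rewrite andbF.
  by move=> v; rewrite big_split /= Fd sumrB !sum1 addrA subrK.
Qed.

(** The double sum meets every edge in both orientations, whence the factor 2; opposite traversals
    of an edge can only cancel. *)
Lemma path_flow_cost (len : G -> G -> nat) (x : G) p : (forall u v, len u v = len v u) ->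
  \sum_u \sum_v (len u v)%:R * `|path_flow x p u v| <= 2 * (path_len len x p)%:R.
Proof.
move=> lsym; elim: p x => [|y p IHp] x /=.
  by rewrite mulr0 big1 // => u _; rewrite big1 // => v _; rewrite normr0 mulr0.
have sum1 (a b : G) : \sum_u \sum_v (len u v)%:R * (((u == a) && (v == b))%:R : R) = (len a b)%:R.
  rewrite (bigD1 a) //= (bigD1 b) //= !eqxx mulr1 [X in _ + X + _]big1 ?addr0; last first.
    by move=> v /negPf ->; rewrite mulr0.
  by rewrite big1 ?addr0 // => u /negPf ->; rewrite big1 // => v _; rewrite mulr0.
apply: (@le_trans _ _ (\sum_u \sum_v ((len u v)%:R * ((u == x) && (v == y))%:R
    + (len u v)%:R * ((u == y) && (v == x))%:R + (len u v)%:R * `|path_flow y p u v|))).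
  apply: ler_sum => u _; apply: ler_sum => v _; rewrite -!mulrDr ler_wpM2l //.
  apply: le_trans (ler_normD _ _) _; rewrite lerD2r /edge_flow.
  by apply: le_trans (ler_normB _ _) _; rewrite !normr_nat.
rewrite (eq_bigr (fun u => \sum_v (len u v)%:R * ((u == x) && (v == y))%:R
    + \sum_v (len u v)%:R * ((u == y) && (v == x))%:R
    + \sum_v (len u v)%:R * `|path_flow y p u v|)); last by move=> u _; rewrite !big_split.
rewrite !big_split /= !sum1 (lsym y x) natrD mulrDr.
by rewrite lerD // mulr_natl.
Qed.

End PathFlow.

(** * Cuts and routing through levels *)

Section Cuts.
Variables (R : realType) (G : capGraph R).

Definition edge_cap (u v : G) : R := if adj u v then cap u v else 0.

Definition cut_cap (S : {set G}) : R := \sum_(u in S) \sum_(v in ~: S) edge_cap u v.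

Lemma edge_cap_ge0 u v : 0 <= edge_cap u v.
Proof. by rewrite /edge_cap; case: ifP => // /cap_gt0/ltW. Qed.

Lemma cut_cap_ge0 S : 0 <= cut_cap S.
Proof. by do 2!apply: sumr_ge0 => ? _; apply: edge_cap_ge0. Qed.

(** Sum the divergence over [S]: the flow inside [S] cancels by antisymmetry. *)
Lemma flow_across_cut s t d (f : G -> G -> R) (S : {set G}) : is_flow s t d f ->
  \sum_(u in S) \sum_(v in ~: S) f u v = d *+ (s \in S) - d *+ (t \in S).
Proof.
move=> [fN _ fdiv].
have S0 : \sum_(u in S) \sum_(v in S) f u v = 0.
  suff : \sum_(u in S) \sum_(v in S) f u v = - \sum_(u in S) \sum_(v in S) f u v by lra.
  rewrite [LHS]exchange_big -sumrN; apply: eq_bigr => u _ /=.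
  by rewrite -sumrN; apply: eq_bigr => v _; apply: fN.
have sum1 x : \sum_(u in S) d *+ (u == x) = d *+ (x \in S).
  have [xS|xS] := boolP (x \in S).
    by rewrite (bigD1 x) //= eqxx big1 ?addr0 // => u /andP[_ /negPf ->].
  by rewrite big1 // => u uS; rewrite (_ : (u == x) = false) //; apply: contraNF xS => /eqP <-.
have : \sum_(u in S) \sum_v f u v = d *+ (s \in S) - d *+ (t \in S).
  by rewrite (eq_bigr _ (fun u _ => fdiv u)) sumrB !sum1.
have -> : \sum_(u in S) \sum_v f u v =
    \sum_(u in S) \sum_(v in S) f u v + \sum_(u in S) \sum_(v in ~: S) f u v.
  rewrite -big_split; apply: eq_bigr => u _ /=.
  rewrite (bigID (mem S)) /=; congr (_ + _).
  by apply: eq_bigl => v; rewrite inE.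
by rewrite S0 add0r.
Qed.

Lemma total_flow_le_congestion (K : {set G}) (D : G -> G -> R) (g : multiflow G) u v :
  routes K D g -> total_flow K g u v <= congestion K g * edge_cap u v.
Proof.
move=> Dg; rewrite /edge_cap; case: ifP => [uv|/negbT nuv].
  rewrite -ler_pdivrMr ?cap_gt0 //.
  exact: (le_bigmax_cond 0 (fun e => total_flow K g e.1 e.2 / cap e.1 e.2)
    (j := (u, v)) uv).
rewrite mulr0 /total_flow big1 // => s sK; rewrite big1 // => t tK.
by have [_ -> //] := Dg s t sK tK; rewrite normr0.
Qed.

Lemma congestion_ge0 (K : {set G}) (g : multiflow G) : 0 <= congestion K g.
Proof. exact: bigmax_ge_id. Qed.

(** A commodity separated by [S] has net flow [D s t] across the boundary, in absolute value, and
    each boundary edge carries at most the congestion times its capacity. *)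
Lemma demand_across_cut (K S : {set G}) (D : G -> G -> R) (g : multiflow G) :
  (forall s t, s \in K -> t \in K -> 0 <= D s t) -> routes K D g ->
  \sum_(s in K) \sum_(t in K) D s t * ((s \in S) != (t \in S))%:R
    <= congestion K g * cut_cap S.
Proof.
move=> D0 Dg.
apply: (@le_trans _ _ (\sum_(s in K) \sum_(t in K) \sum_(u in S) \sum_(v in ~: S) `|g s t u v|)).
  apply: ler_sum => s sK; apply: ler_sum => t tK.
  have -> : D s t * ((s \in S) != (t \in S))%:R = `|D s t *+ (s \in S) - D s t *+ (t \in S)|.
    by case: (s \in S); case: (t \in S); rewrite /= ?mulr1n ?mulr0n ?subrr ?sub0r ?subr0 ?normrN ?normr0 ?mulr0 ?mulr1 ?ger0_norm ?D0.
  rewrite -(flow_across_cut S (Dg s t sK tK)).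
  apply: le_trans (ler_norm_sum _ _ _) _; apply: ler_sum => u _.
  exact: ler_norm_sum.
apply: (@le_trans _ _ (\sum_(u in S) \sum_(v in ~: S) total_flow K g u v)); last first.
  rewrite /cut_cap mulr_sumr; apply: ler_sum => u _; rewrite mulr_sumr.
  by apply: ler_sum => v _; apply: total_flow_le_congestion Dg.
rewrite (eq_bigr (fun s => \sum_(u in S) \sum_(v in ~: S) \sum_(t in K) `|g s t u v|)); last first.
  move=> s _; rewrite exchange_big; apply: eq_bigr => u _; exact: exchange_big.
rewrite exchange_big /= le_eqVlt; apply/orP; left; apply/eqP; apply: eq_bigr => u _.
exact: exchange_big.
Qed.

Lemma flow_cat a b x d (f f' : G -> G -> R) : is_flow a b d f -> is_flow b x d f' ->
  is_flow a x d (fun u v => f u v + f' u v).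
Proof.
move=> [fN fA fD] [fN' fA' fD']; split=> [u v|u v uv|v].
- by rewrite fN fN' opprD.
- by rewrite fA // fA' // addr0.
- by rewrite big_split /= fD fD' addrA subrK.
Qed.

Lemma flow_sub a b x d (f f' : G -> G -> R) : is_flow a x d f -> is_flow b x d f' ->
  is_flow a b d (fun u v => f u v - f' u v).
Proof.
move=> ax [fN' fA' fD']; apply: flow_cat ax _; split=> [u v|u v uv|v].
- by rewrite fN' opprK.
- by rewrite fA' // oppr0.
- by rewrite sumrN fD' opprB.
Qed.

Lemma flow_chain (phi : nat -> G) (h : G -> G -> G -> G -> R) J :
  (forall j, (j < J)%N -> is_flow (phi j) (phi j.+1) 1 (h (phi j) (phi j.+1))) ->
  is_flow (phi 0%N) (phi J) 1 (fun u v => \sum_(j < J) h (phi j) (phi j.+1) u v).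
Proof.
elim: J => [|J IHJ] hJ.
  by split=> [u v|u v _|v]; rewrite ?big_ord0 ?oppr0 ?subrr // big1 // => w _; rewrite big_ord0.
have [fN fA fD] := flow_cat (IHJ (fun j jJ => hJ j (ltnW jJ))) (hJ J (ltnSn J)).
split=> [u v|u v uv|v].
- by rewrite !big_ord_recr /= fN.
- by rewrite !big_ord_recr /= fA.
- by rewrite -fD; apply: eq_bigr => w _; rewrite big_ord_recr.
Qed.

Section Levels.
(** [F j] sends a vertex to its image at level [j]; [h a b] is the flow used for a hop from [a] to
    [b]. *)
Variables (K : {set G}) (J : nat) (F : nat -> G -> option G).
Variable h : G -> G -> G -> G -> R.
Hypothesis h_flow : forall a b, connect (@adj R G) a b -> is_flow a b 1 (h a b).
Hypothesis F0 : forall s, s \in K -> F 0%N s = Some s.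
Hypothesis F_some : forall j s, s \in K -> F j s != None.
Hypothesis F_connect : forall j v a, F j v = Some a -> connect (@adj R G) v a.
Hypothesis F_last : forall s t, s \in K -> t \in K -> connect (@adj R G) s t -> F J s = F J t.

Definition hop_set (j : nat) (a b : G) : {set G} :=
  [set v | (F j v == Some a) && (F j.+1 v == Some b)].

(** The climb of [s] minus the climb of [t], written hop by hop: a hop made by both at the same
    level has coefficient 0, so only demand separated by its hop set loads it. *)
Definition level_flow : multiflow G := fun s t u v =>
  \sum_(j < J) \sum_a \sum_b
    ((s \in hop_set j a b)%:R - (t \in hop_set j a b)%:R) * h a b u v.

Definition level_load (u v : G) : R :=
  \sum_(j < J) \sum_a \sum_b `|h a b u v| * cut_cap (hop_set j a b).

(** The climbs from [s] and [t] are chains of hops that meet at level [J] by [F_last], so their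
    difference is a unit flow from [s] to [t]. *)
Lemma level_flow_scheme : routing_scheme K level_flow.
Proof.
have csym : connect_sym (@adj R G) by apply: sym_connect_sym; apply: adj_sym.
have up s : s \in K -> exists phi : nat -> G, [/\ phi 0%N = s, forall j, F j s = Some (phi j)
    & is_flow s (phi J) 1 (fun u v => \sum_(j < J) \sum_a \sum_b (s \in hop_set j a b)%:R * h a b u v)].
  (* The default [s] is never taken, by [F_some]. *)
  move=> sK; pose phi j := odflt s (F j s).
  have Fphi j : F j s = Some (phi j) by rewrite /phi; have := F_some j sK; case: (F j s).
  have phi0 : phi 0%N = s by rewrite /phi F0.
  exists phi; split => //; rewrite -{1}phi0.
  have hop : is_flow (phi 0%N) (phi J) 1 (fun u v => \sum_(j < J) h (phi j) (phi j.+1) u v).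
    apply: flow_chain => j _; apply: h_flow; apply: (@connect_trans _ _ s).
      by rewrite csym; apply: F_connect (Fphi j).
    exact: F_connect (Fphi j.+1).
  suff e u v : \sum_(j < J) \sum_a \sum_b (s \in hop_set j a b)%:R * h a b u v
      = \sum_(j < J) h (phi j) (phi j.+1) u v.
    case: hop => [fN fA fD]; split=> [u v|u v uv|v]; rewrite ?e //; first exact: fA.
    by rewrite -fD; apply: eq_bigr => w _; rewrite e.
  apply: eq_bigr => j _; rewrite (bigD1 (phi j)) //= (bigD1 (phi j.+1)) //=.
  rewrite inE !Fphi !eqxx mul1r [X in _ + X + _]big1 ?addr0; last first.
    by move=> b /negPf nb; rewrite inE !Fphi [Some _ == Some b]eq_sym [Some b == _]nb andbF mul0r.
  rewrite big1 ?addr0 // => a /negPf na; rewrite big1 // => b _.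
  by rewrite inE !Fphi [Some _ == Some a]eq_sym [Some a == _]na mul0r.
move=> s t sK tK st.
have [phi [_ Fs fs]] := up s sK; have [psi [_ Ft ft]] := up t tK.
have e : phi J = psi J by apply: Some_inj; rewrite -Fs -Ft; apply: F_last.
rewrite -e in ft; case: (flow_sub fs ft) => fN fA fD.
have E u v : level_flow s t u v = \sum_(j < J) \sum_a \sum_b (s \in hop_set j a b)%:R * h a b u v
   - \sum_(j < J) \sum_a \sum_b (t \in hop_set j a b)%:R * h a b u v.
  rewrite -sumrB; apply: eq_bigr => j _; rewrite -sumrB; apply: eq_bigr => a _.
  by rewrite -sumrB; apply: eq_bigr => b _; rewrite mulrBl.
split=> [u v|u v uv|v]; rewrite ?E //; first exact: fA.
by rewrite -fD; apply: eq_bigr => w _.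
Qed.

(** Triangle inequality over the hops, then [demand_across_cut] for each hop set. *)
Lemma level_flow_load (D : G -> G -> R) (g : multiflow G) u v :
  (forall s t, s \in K -> t \in K -> 0 <= D s t) -> routes K D g ->
  \sum_(s in K) \sum_(t in K) D s t * `|level_flow s t u v|
    <= congestion K g * level_load u v.
Proof.
move=> D0 Dg.
pose T (i : 'I_J * G * G) s t : R := ((s \in hop_set i.1.1 i.1.2 i.2) != (t \in hop_set i.1.1 i.1.2 i.2))%:R.
have -> : level_load u v = \sum_(i : 'I_J * G * G) `|h i.1.2 i.2 u v| * cut_cap (hop_set i.1.1 i.1.2 i.2).
  by rewrite /level_load pair_bigA pair_bigA.
apply: (@le_trans _ _ (\sum_(s in K) \sum_(t in K) \sum_i `|h i.1.2 i.2 u v| * (D s t * T i s t))).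
  apply: ler_sum => s sK; apply: ler_sum => t tK.
  rewrite /level_flow pair_bigA pair_bigA /=.
  apply: le_trans (ler_wpM2l (D0 s t sK tK) (ler_norm_sum _ _ _)) _.
  rewrite mulr_sumr; apply: ler_sum => i _; rewrite normrM [`|_ - _| * _]mulrC mulrCA.
  rewrite ler_wpM2l // ler_wpM2l ?D0 // /T.
  by case: (s \in _); case: (t \in _); rewrite /= ?subrr ?subr0 ?sub0r ?normrN ?normr1 ?normr0.
rewrite (eq_bigr (fun s => \sum_i \sum_(t in K) `|h i.1.2 i.2 u v| * (D s t * T i s t))); last first.
  by move=> s _; apply: exchange_big.
rewrite exchange_big mulr_sumr; apply: ler_sum => i _ /=.
rewrite mulrCA (eq_bigr (fun s => `|h i.1.2 i.2 u v| * \sum_(t in K) D s t * T i s t)); last first.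
  by move=> s _; rewrite mulr_sumr.
by rewrite -mulr_sumr ler_wpM2l //; apply: demand_across_cut.
Qed.

Lemma level_load_ge0 u v : 0 <= level_load u v.
Proof.
by do 3!(apply: sumr_ge0 => ? _); rewrite mulr_ge0 // cut_cap_ge0.
Qed.

End Levels.
End Cuts.

(** * Routing for integral edge lengths *)

Lemma exists_le_average (R : realType) (I : finType) (i0 : I) (Y : I -> R) :
  exists i, #|I|%:R * Y i <= \sum_i Y i.
Proof.
have [i _ imin] := arg_minP Y (erefl (xpredT i0)).
exists i; rewrite mulr_natl -sumr_const; apply: ler_sum => j _; exact: imin.
Qed.

(** Some radius in the block from [2 ^ j] to [2 ^ j.+1] has [X] at most the block average, so
    [2 ^ j] times this value is at most the block sum. That radius becomes [rho j.+1], weighted by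
    [2 ^+ j.+1], whence the factor 2. *)
Lemma dyadic_radii (R : realType) (X : nat -> R) : (forall r, 0 <= X r) ->
  exists rho : nat -> nat,
    [/\ rho 0%N = 0%N, forall j, (rho j < 2 ^ j)%N, forall j, (2 ^ j <= rho j.+1)%N
      & forall J, \sum_(j < J.+1) 2 ^+ j * X (rho j) <= 2 * \sum_(r < 2 ^ J) X r].
Proof.
move=> X0.
have pick j : exists r, [/\ (2 ^ j <= r)%N, (r < 2 ^ j.+1)%N
    & 2 ^+ j * X r <= \sum_(i < 2 ^ j) X (2 ^ j + i)%N].
  have p0 : (0 < 2 ^ j)%N by rewrite expn_gt0.
  have [i] := exists_le_average (Ordinal p0) (fun i : 'I_(2 ^ j) => X (2 ^ j + i)%N).
  rewrite card_ord natrX => avg; exists (2 ^ j + i)%N; split=> //; first exact: leq_addr.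
  by rewrite expnS mul2n -addnn ltn_add2l.
have [rho rhoP] := choice pick.
(* Level 0 gets radius 0, so that a terminal starts at itself; block [j] serves level [j.+1]. *)
exists (fun j => if j is j'.+1 then rho j' else 0%N); split=> //.
- by case=> // j; case: (rhoP j).
- by move=> j; case: (rhoP j).
elim=> [|J IHJ].
  by rewrite !big_ord_recl !big_ord0 !addr0 expr0; have := X0 0%N; lra.
rewrite big_ord_recr /= exprS -mulrA; have [_ _ h] := rhoP J.
have -> : \sum_(r < 2 ^ J.+1) X r = \sum_(r < 2 ^ J) X r + \sum_(i < 2 ^ J) X (2 ^ J + i)%N.
  by rewrite (_ : 2 ^ J.+1 = 2 ^ J + 2 ^ J)%N ?big_split_ord // expnS mul2n addnn.
by rewrite mulrDr lerD // ler_wpM2l.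
Qed.

Section Core.
Variables (R : realType) (G : capGraph R) (K : {set G}) (len : G -> G -> nat).
Hypothesis K_gt0 : (0 < #|K|)%N.
Hypothesis len_sym : forall u v, len u v = len v u.
Hypothesis len_gt0 : forall u v, adj u v -> (0 < len u v)%N.

Let d := dist (@adj R G) len.
Let conn := connect (@adj R G).

Let conn_sym : symmetric conn.
Proof. by apply: sym_connect_sym; apply: adj_sym. Qed.

Let d_sym : forall u v, d u v = d v u.
Proof. by apply: dist_sym => //; apply: adj_sym. Qed.

(** Connectivity is required explicitly because [dist] is 0 across components. *)
Definition reachable_terminals (u : G) := [set t in K | conn t u].

(* [None] when no terminal lies within [r]: such vertices belong to no hop set. *)
Definition center (pi : {perm G}) (r : nat) (u : G) : option G :=
  first pi [set t in reachable_terminals u | (d t u <= r)%N].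

Definition separated_cap (pi : {perm G}) (r : nat) : R :=
  \sum_u \sum_v edge_cap u v * (center pi r u != center pi r v)%:R.

Definition volume : R := \sum_u \sum_v edge_cap u v * (len u v)%:R.

Lemma reachable_terminals_eq u v : conn u v -> reachable_terminals u = reachable_terminals v.
Proof.
move=> uv; apply/setP => t; rewrite !inE; congr (_ && _).
by apply/idP/idP => /connect_trans; apply; rewrite // -/conn conn_sym.
Qed.

Lemma separated_cap_ge0 pi r : 0 <= separated_cap pi r.
Proof. by do 2!(apply: sumr_ge0 => ? _); rewrite mulr_ge0 ?edge_cap_ge0. Qed.

(** The two ends of an edge reach the same terminals, at distances differing by at most the edge
    length, so [sum_first_neq_le] applies to each edge. *)
Lemma sum_separated_cap N :
  \sum_pi \sum_(r < N) separated_cap pi r <= #|{perm G}|%:R * ((1 + ln #|K|%:R) * volume).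
Proof.
have -> : \sum_pi \sum_(r < N) separated_cap pi r = \sum_u \sum_v edge_cap u v *
    \sum_pi \sum_(r < N) (center pi r u != center pi r v)%:R.
  rewrite pair_bigA exchange_big /=; apply: eq_bigr => u _.
  rewrite exchange_big /=; apply: eq_bigr => v _.
  by rewrite pair_bigA mulr_sumr.
rewrite /volume !mulr_sumr; apply: ler_sum => u _; rewrite !mulr_sumr; apply: ler_sum => v _.
rewrite {1 2}/edge_cap; case: ifP => [uv|_]; last by rewrite !mul0r !mulr0.
rewrite [leRHS](_ : _ = cap u v * (#|{perm G}|%:R * (1 + ln #|K|%:R) * (len u v)%:R)); last by ring.
rewrite ler_wpM2l ?(ltW (cap_gt0 uv)) // /center.
rewrite -(reachable_terminals_eq (connect1 uv)).
apply: le_trans (@sum_first_neq_le G R _ (d^~ u) (d^~ v) (len u v) N _ _) _.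
- move=> t _; rewrite len_sym; apply: dist_adj; [exact: adj_sym|by rewrite adj_sym].
- by move=> t _; apply: dist_adj => //; apply: adj_sym.
rewrite ler_wpM2r // ler_wpM2l // lerD2l.
have [A0|Agt] := posnP #|reachable_terminals u|.
  by rewrite A0 ln0 // ln_ge0 // ler1n.
rewrite ler_ln ?posrE ?ltr0n // ler_nat subset_leq_card //.
by apply/subsetP => t; rewrite inE => /andP[].
Qed.

Lemma exists_good_order N :
  exists pi, \sum_(r < N) separated_cap pi r <= (1 + ln #|K|%:R) * volume.
Proof.
have [pi avg] := exists_le_average (1%g : {perm G}) (fun pi => \sum_(r < N) separated_cap pi r).
exists pi; have := le_trans avg (sum_separated_cap N).
by rewrite ler_pM2l // ltr0n; apply/card_gt0P; exists 1%g.
Qed.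

Lemma exists_shortest_flows : exists h : G -> G -> G -> G -> R,
  forall a b, conn a b -> is_flow a b 1 (h a b) /\
    \sum_u \sum_v (len u v)%:R * `|h a b u v| <= 2 * (d a b)%:R.
Proof.
have H (e : G * G) : exists f : G -> G -> R, conn e.1 e.2 -> is_flow e.1 e.2 1 f /\
    \sum_u \sum_v (len u v)%:R * `|f u v| <= 2 * (d e.1 e.2)%:R.
  have [c|nc] := boolP (conn e.1 e.2); last by exists (fun _ _ => 0).
  have [p [ap pb pd]] := dist_path len c.
  exists (path_flow e.1 p) => _; split; first by rewrite -pb; apply: path_flow_is_flow.
  by rewrite /d -pd; apply: path_flow_cost.
have [h hP] := choice H.
by exists (fun a b => h (a, b)) => a b; apply: (hP (a, b)).
Qed.

Lemma center_some pi r u a : center pi r u = Some a ->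
  [/\ a \in K, conn a u & (d a u <= r)%N].
Proof.
by move/eqP; rewrite firstE => /andP[]; rewrite !inE -andbA => /and3P[].
Qed.

Lemma center_terminal pi r s : s \in K -> center pi r s != None.
Proof.
move=> sK; have [t] : exists t, is_first pi [set t in reachable_terminals s | (d t s <= r)%N] t.
  by apply: (@exists_is_first _ _ _ s); rewrite !inE sK /d dist0 /conn connect0.
by rewrite -firstE /center => /eqP ->.
Qed.

Lemma sum_eq_Some (x : option G) : \sum_a ((x == Some a)%:R : R) <= 1.
Proof.
case: x => [a|]; last by rewrite big1.
rewrite (bigD1 a) //= eqxx big1 ?addr0 // => b /negPf nb.
by rewrite [Some a == _]eq_sym [Some b == _]nb.
Qed.

(** An edge leaving a hop set has ends with different centers at one of the two levels, and each
    vertex lies in at most one hop set of level [j]. *)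
Lemma sum_cut_hop_set pi (rho : nat -> nat) j :
  \sum_a \sum_b cut_cap (hop_set (fun j => center pi (rho j)) j a b)
    <= separated_cap pi (rho j) + separated_cap pi (rho j.+1).
Proof.
set S := hop_set _ j.
have cutE (A : {set G}) : cut_cap A = \sum_u \sum_v edge_cap u v * ((u \in A) && (v \notin A))%:R.
  rewrite /cut_cap big_mkcond; apply: eq_bigr => u _; case: (u \in A) => /=; last first.
    by rewrite big1 // => v _; rewrite mulr0.
  rewrite big_mkcond; apply: eq_bigr => v _; rewrite inE.
  by case: (v \in A) => /=; rewrite ?mulr0 ?mulr1.
rewrite /separated_cap -big_split /=.
have -> : \sum_a \sum_b cut_cap (S a b) = \sum_u \sum_v edge_cap u v *
    \sum_a \sum_b ((u \in S a b) && (v \notin S a b))%:R.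
  under eq_bigr => a _ do under eq_bigr => b _ do rewrite cutE.
  rewrite pair_bigA exchange_big /=; apply: eq_bigr => u _.
  rewrite exchange_big /=; apply: eq_bigr => v _.
  by rewrite pair_bigA mulr_sumr.
apply: ler_sum => u _; rewrite -big_split /=; apply: ler_sum => v _.
rewrite -mulrDr ler_wpM2l ?edge_cap_ge0 //.
set rhs := (X in _ <= X).
have rhs0 : 0 <= rhs by rewrite addr_ge0.
apply: (@le_trans _ _ (\sum_a \sum_b rhs * ((center pi (rho j) u == Some a)%:R *
    (center pi (rho j.+1) u == Some b)%:R))).
  apply: ler_sum => a _; apply: ler_sum => b _.
  rewrite /S !inE /rhs.
  case: eqP => [->|_] /=; last by rewrite mul0r mulr0.
  case: eqP => [->|_] /=; last by rewrite !mulr0.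
  rewrite !mulr1 negb_and !(eq_sym (center _ _ v)).
  by case: (Some a == _); case: (Some b == _); rewrite /= ?addr0 ?add0r // lerDl.
under eq_bigr => a _ do rewrite -mulr_sumr -mulr_sumr.
rewrite -mulr_sumr -mulr_suml -[leRHS]mulr1 ler_wpM2l // -[leRHS]mulr1.
by apply: ler_pM; rewrite ?sum_eq_Some //; apply: sumr_ge0.
Qed.

(** An empty hop set has cut capacity 0. Otherwise a member lies within [rho j] of [a] and
    [rho j.+1] of [b], so [d a b < 3 * 2 ^ j], which the cost bound on [h] doubles. *)
Lemma hop_cost pi (rho : nat -> nat) (h : G -> G -> G -> G -> R) j a b :
  (forall j, (rho j < 2 ^ j)%N) ->
  (forall a b, conn a b -> is_flow a b 1 (h a b) /\
     \sum_u \sum_v (len u v)%:R * `|h a b u v| <= 2 * (d a b)%:R) ->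
  (\sum_u \sum_v (len u v)%:R * `|h a b u v|)
      * cut_cap (hop_set (fun j => center pi (rho j)) j a b)
    <= 6 * 2 ^+ j * cut_cap (hop_set (fun j => center pi (rho j)) j a b).
Proof.
move=> rho_lt hP; set S := hop_set _ j a b; have [S0|[v]] := set_0Vmem S.
  by rewrite S0 /cut_cap big_set0 !mulr0.
rewrite inE => /andP[/eqP/center_some[_ av dav] /eqP/center_some[_ bv dbv]].
have vb : conn v b by rewrite conn_sym.
have [_ cost] := hP _ _ (connect_trans av vb).
rewrite ler_wpM2r ?cut_cap_ge0 //; apply: le_trans cost _.
rewrite (_ : 6 * 2 ^+ j = 2 * (3 * 2 ^ j)%:R :> R); last by rewrite natrM natrX; ring.
rewrite ler_wpM2l // ler_nat.
have := dist_triangle len av vb; rewrite -/d [d v b]d_sym.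
by have := rho_lt j; have := rho_lt j.+1; rewrite expnS; lia.
Qed.

Lemma exists_level_routing : exists f : multiflow G, exists load : G -> G -> R,
  [/\ routing_scheme K f, forall u v, 0 <= load u v,
      forall (D : G -> G -> R) (g : multiflow G) u v,
        (forall s t, s \in K -> t \in K -> 0 <= D s t) -> routes K D g ->
        \sum_(s in K) \sum_(t in K) D s t * `|f s t u v| <= congestion K g * load u v
    & \sum_u \sum_v (len u v)%:R * load u v <= 18 * ((1 + ln #|K|%:R) * volume)].
Proof.
have [h hP] := exists_shortest_flows.
(* [2 ^ J'] exceeds every distance and [rho J] is at least [2 ^ J'], so at level [J] every reachable
   terminal is within the radius. *)
pose J' := (\sum_a \sum_b d a b)%N; pose J := J'.+1.
have dJ a b : (d a b <= 2 ^ J')%N.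
  apply: leq_trans (ltnW (@ltn_expl 2 _ isT)) _.
  rewrite leq_exp2l //; apply: (@leq_trans (\sum_b d a b)%N).
    by rewrite (bigD1 b) //= leq_addr.
  by rewrite /J' [leqRHS](bigD1 a) //= leq_addr.
have [pi piP] := exists_good_order (2 ^ J).
have [rho [rho0 rho_lt rho_ge rho_sum]] := dyadic_radii (separated_cap_ge0 pi).
pose F j := center pi (rho j).
(* At radius 0 the only candidate is [s] itself, as edge lengths are positive. *)
have F0 s : s \in K -> F 0%N s = Some s.
  move=> sK; have := center_terminal pi (rho 0%N) sK; rewrite /F rho0.
  case e : (center _ _ _) => [a|] // _; have [_ c] := center_some e.
  by rewrite leqn0 => /eqP/(dist_eq0 len_gt0 c) ->.
have FJ s t : s \in K -> t \in K -> conn s t -> F J s = F J t.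
  move=> sK tK st; rewrite /F /center (reachable_terminals_eq st); congr first.
  apply/setP => x; rewrite !inE.
  by rewrite !(leq_trans (dJ _ _) (rho_ge _)).
have FC j v a : F j v = Some a -> conn v a.
  by move=> /center_some[_ c _]; rewrite conn_sym.
exists (level_flow J F h), (level_load J F h); split.
- apply: (level_flow_scheme _ F0 _ FC FJ); first by move=> a b /hP[].
  by move=> j s; apply: center_terminal.
- exact: level_load_ge0.
- by move=> D g u v; apply: level_flow_load.
have -> : \sum_u \sum_v (len u v)%:R * level_load J F h u v =
    \sum_(j < J) \sum_a \sum_b (\sum_u \sum_v (len u v)%:R * `|h a b u v|) * cut_cap (hop_set F j a b).
  rewrite /level_load; under eq_bigr => u _ do under eq_bigr => v _ do rewrite mulr_sumr.
  rewrite pair_bigA exchange_big /=; apply: eq_bigr => j _.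
  under eq_bigr => e _ do rewrite mulr_sumr.
  rewrite exchange_big /=; apply: eq_bigr => a _.
  under eq_bigr => e _ do rewrite mulr_sumr.
  rewrite exchange_big /=; apply: eq_bigr => b _.
  by rewrite pair_bigA mulr_suml; apply: eq_bigr => e _ /=; rewrite mulrA.
pose X r := separated_cap pi r.
apply: (@le_trans _ _ (\sum_(j < J) 6 * 2 ^+ j * (X (rho j) + X (rho j.+1)))).
  apply: ler_sum => j _.
  apply: (@le_trans _ _ (\sum_a \sum_b 6 * 2 ^+ j * cut_cap (hop_set F j a b))).
    by apply: ler_sum => a _; apply: ler_sum => b _; apply: hop_cost.
  under eq_bigr => a _ do rewrite -mulr_sumr.
  rewrite -mulr_sumr ler_wpM2l ?mulr_ge0 ?exprn_ge0 //.
  exact: sum_cut_hop_set.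
(* The terms in [rho j] sum to at most [Z], those in [rho j.+1] to at most [Z / 2] because their
   weights are halved. The cost is thus at most [9 * Z], and [ZY] turns 9 into 18. *)
set Z := \sum_(j < J.+1) 2 ^+ j * X (rho j).
have ZY : Z <= 2 * ((1 + ln #|K|%:R) * volume).
  by apply: le_trans (rho_sum J) _; rewrite ler_wpM2l.
have term0 j : 0 <= 2 ^+ j * X (rho j) by rewrite mulr_ge0 ?exprn_ge0 // separated_cap_ge0.
have Z1 : \sum_(j < J) 2 ^+ j * X (rho j) <= Z.
  by rewrite /Z [leRHS]big_ord_recr /= lerDl.
have Z2 : 2 * \sum_(j < J) 2 ^+ j * X (rho j.+1) <= Z.
  have -> : 2 * \sum_(j < J) 2 ^+ j * X (rho j.+1) = \sum_(j < J) 2 ^+ j.+1 * X (rho j.+1).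
    by rewrite mulr_sumr; apply: eq_bigr => j _; rewrite mulrA -exprS.
  by rewrite /Z [leRHS]big_ord_recl lerDr (term0 0%N).
have -> : \sum_(j < J) 6 * 2 ^+ j * (X (rho j) + X (rho j.+1)) =
  6 * \sum_(j < J) 2 ^+ j * X (rho j) + 6 * \sum_(j < J) 2 ^+ j * X (rho j.+1).
  by rewrite !mulr_sumr -big_split; apply: eq_bigr => j _ /=; ring.
lra.
Qed.

End Core.

(** * From integral lengths to oblivious routing *)

Section Assembly.
Variables (R : realType) (G : capGraph R) (K : {set G}).

(* [x] bounds the load of each edge, relative to its capacity and to the
   congestion of an arbitrary routing of the demands. *)
Definition routable (sigma : R) (x : G * G -> R) : Prop :=
  exists f : multiflow G,
    (forall s t, s \in K -> t \in K -> connect (@adj R G) s t -> is_flow s t sigma (f s t)) /\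
    forall (D : G -> G -> R) (g : multiflow G) u v,
      adj u v -> (forall s t, s \in K -> t \in K -> 0 <= D s t) -> routes K D g ->
      \sum_(s in K) \sum_(t in K) D s t * `|f s t u v|
        <= congestion K g * (cap u v * x (u, v)).

Lemma routable0 : routable 0 (fun=> 0).
Proof.
exists (fun _ _ _ _ => 0); split.
  move=> s t _ _ _; split=> [u v|u v _|v]; rewrite ?oppr0 //.
  by rewrite !mul0rn subrr big1.
move=> D g u v _ _ _; rewrite !mulr0 big1 // => s _; rewrite big1 // => t _.
by rewrite normr0 mulr0.
Qed.

Lemma routableD s t x y : routable s x -> routable t y ->
  routable (s + t) (fun e => x e + y e).
Proof.
move=> [f [fF fL]] [f' [fF' fL']]; exists (fun a b u v => f a b u v + f' a b u v); split.
  move=> a b aK bK ab; have [fN fA fD] := fF _ _ aK bK ab; have [fN' fA' fD'] := fF' _ _ aK bK ab.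
  split=> [u v|u v uv|v].
  - by rewrite fN fN' opprD.
  - by rewrite fA // fA' // addr0.
  - by rewrite big_split /= fD fD' !mulrnDl; ring.
move=> D g u v uv D0 Dg; rewrite !mulrDr.
apply: le_trans (lerD (fL _ _ _ _ uv D0 Dg) (fL' _ _ _ _ uv D0 Dg)).
rewrite -big_split; apply: ler_sum => a aK; rewrite -big_split; apply: ler_sum => b bK /=.
by rewrite -mulrDr ler_wpM2l ?D0 // ler_normD.
Qed.

Lemma routableZ (a s : R) x : 0 <= a -> routable s x -> routable (a * s) (fun e => a * x e).
Proof.
move=> a0 [f [fF fL]]; exists (fun p q u v => a * f p q u v); split.
  move=> p q pK qK pq; have [fN fA fD] := fF _ _ pK qK pq; split=> [u v|u v uv|v].
  - by rewrite fN mulrN.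
  - by rewrite fA // mulr0.
  - by rewrite -mulr_sumr fD mulrBr !mulrnAr.
move=> D g u v uv D0 Dg; rewrite [leRHS](_ : _ = a * (congestion K g * (cap u v * x (u, v)))); last by ring.
apply: le_trans (ler_wpM2l a0 (fL _ _ _ _ uv D0 Dg)).
rewrite mulr_sumr; apply: ler_sum => p pK; rewrite mulr_sumr; apply: ler_sum => q qK.
by rewrite normrM ger0_norm // mulrCA.
Qed.

(** The scale [M] exceeds every inverse length, so each scaled length is at least 1 and passing to
    the next integer at most doubles it. *)
Lemma nat_lengths (l : G -> G -> R) :
  (forall u v, l u v = l v u) -> (forall u v, adj u v -> 0 < l u v) ->
  exists len : G -> G -> nat, exists2 M : R, 0 < M &
    [/\ forall u v, len u v = len v u, forall u v, adj u v -> (0 < len u v)%N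
      & forall u v, adj u v -> M * l u v <= (len u v)%:R <= 2 * (M * l u v)].
Proof.
move=> l_sym l_gt0.
pose M : R := 1 + \sum_u \sum_(v | adj u v) (l u v)^-1.
have inv0 u v : adj u v -> 0 <= (l u v)^-1 by move=> uv; rewrite invr_ge0 ltW ?l_gt0.
have S0 u : 0 <= \sum_(v | adj u v) (l u v)^-1 by apply: sumr_ge0 => v; apply: inv0.
have M0 : 0 < M by rewrite ltr_wpDr ?sumr_ge0.
exists (fun u v => (Num.trunc (M * l u v)).+1), M => //; split => // [u v|u v uv].
  by rewrite l_sym.
have Ml1 : 1 <= M * l u v.
  rewrite -ler_pdivrMr ?l_gt0 // div1r.
  have h1 : (l u v)^-1 <= \sum_(z | adj u z) (l u z)^-1.
    by rewrite (bigD1 v) //= lerDl; apply: sumr_ge0 => z /andP[/inv0].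
  have h2 : \sum_(z | adj u z) (l u z)^-1 <= \sum_u \sum_(v | adj u v) (l u v)^-1.
    by rewrite [leRHS](bigD1 u) //= lerDl sumr_ge0.
  by apply: le_trans h1 (le_trans h2 _); rewrite lerDr.
have Ml0 : 0 <= M * l u v by apply: le_trans Ml1.
rewrite (ltW (truncnS_gt _)) /=; have /andP[h _] := truncn_itv Ml0.
by rewrite -natr1; lra.
Qed.

(** Dividing weight by capacity makes length times load a weighted relative load, and length times
    capacity a weight. Here 72 is 18 times 2 for rounding the lengths, times 2 for adding the
    weights of both orientations. *)
Lemma routing_for_weights (w : G * G -> R) : (0 < #|K|)%N -> (forall e, 0 < w e) ->
  exists x, [/\ routable 1 x, forall e, 0 <= x e
    & \sum_e w e * x e <= 72 * (1 + ln #|K|%:R) * \sum_e w e].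
Proof.
move=> K0 w0.
pose l u v : R := (w (u, v) + w (v, u)) / cap u v.
have l_sym u v : l u v = l v u by rewrite /l addrC cap_sym.
have l_gt0 u v : adj u v -> 0 < l u v by move=> uv; rewrite divr_gt0 ?cap_gt0 ?addr_gt0.
have [len [M M0 [len_sym len_gt0 lenP]]] := nat_lengths l_sym l_gt0.
have [f [load [fS load0 fL cost]]] := exists_level_routing K0 len_sym len_gt0.
pose x (e : G * G) := if adj e.1 e.2 then load e.1 e.2 / cap e.1 e.2 else 0.
have ln0' : 0 <= 1 + ln (#|K|%:R : R) by rewrite addr_ge0 // ln_ge0 // ler1n.
exists x; split.
- exists f; split => // D g u v uv D0 Dg; rewrite /x /= uv.
  by rewrite [cap u v * _]mulrC divfK ?gt_eqF ?cap_gt0 //; apply: fL.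
- by move=> [u v]; rewrite /x /=; case: ifP => // uv; rewrite divr_ge0 // ltW ?cap_gt0.
have lower : M * \sum_e w e * x e <= \sum_u \sum_v (len u v)%:R * load u v.
  rewrite pair_bigA mulr_sumr; apply: ler_sum => -[u v] _ /=; rewrite /x /=.
  case: ifP => [uv|_]; last by rewrite !mulr0 mulr_ge0.
  rewrite [leLHS](_ : _ = M * (w (u, v) / cap u v) * load u v); last by ring.
  rewrite ler_wpM2r //; have /andP[h _] := lenP u v uv; apply: le_trans h.
  rewrite ler_wpM2l ?(ltW M0) // ler_wpM2r ?invr_ge0 ?(ltW (cap_gt0 uv)) // lerDl.
  exact: ltW.
have upper : volume len <= M * (4 * \sum_e w e).
  apply: (@le_trans _ _ (\sum_u \sum_v 2 * M * (w (u, v) + w (v, u)))).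
    apply: ler_sum => u _; apply: ler_sum => v _; rewrite /edge_cap; case: ifP => [uv|_].
      have /andP[_ h] := lenP u v uv.
      apply: le_trans (ler_wpM2l (ltW (cap_gt0 uv)) h) _.
      rewrite /l le_eqVlt; apply/orP; left; apply/eqP.
      by field; rewrite gt_eqF ?cap_gt0.
    by rewrite mul0r !mulr_ge0 ?addr_ge0 // ltW.
  under eq_bigr => u _ do rewrite -mulr_sumr big_split.
  rewrite -mulr_sumr big_split /= [X in _ + X]exchange_big /=.
  have -> : \sum_u \sum_v w (u, v) = \sum_e w e.
    by rewrite pair_bigA; apply: eq_bigr => -[].
  by rewrite le_eqVlt; apply/orP; left; apply/eqP; ring.
rewrite -(ler_pM2l M0); apply: le_trans lower _; apply: le_trans cost _.
apply: le_trans (ler_wpM2l _ (ler_wpM2l ln0' upper)) _ => //.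
by rewrite le_eqVlt; apply/orP; left; apply/eqP; ring.
Qed.

(** After division by [alpha] the claim is a lower bound on an infimum, checked against each routing
    [g] of [D]; this also covers demands that cannot be routed. *)
Lemma routable_oblivious (alpha : R) (x : G * G -> R) :
  0 < alpha -> routable 1 x -> (forall e, x e <= alpha) ->
  exists f : multiflow G, oblivious alpha K f.
Proof.
move=> a0 [f [fS fL]] xa; exists f; split => // D D0.
rewrite -lee_pdivrMl // -EFinM; apply: le_ereal_inf_tmp => _ [g Dg <-].
rewrite lee_fin mulrC ler_pdivrMr //.
apply: bigmax_le => [|[u v] /= uv]; first by rewrite mulr_ge0 ?congestion_ge0 // ltW.
rewrite ler_pdivrMr ?cap_gt0 //.
have -> : total_flow K (oblivious_routing f D) u v =
    \sum_(s in K) \sum_(t in K) D s t * `|f s t u v|.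
  apply: eq_bigr => s sK; apply: eq_bigr => t tK.
  by rewrite /oblivious_routing normrM ger0_norm ?D0.
apply: le_trans (fL D g u v uv D0 Dg) _.
by rewrite -mulrA ler_wpM2l ?congestion_ge0 // mulrC ler_wpM2r ?(ltW (cap_gt0 uv)) ?xa.

Qed.

End Assembly.

Theorem mainTheorem17 (R : realType) :
  exists2 C : R, 0 < C &
    forall (G : capGraph R) (K : {set G}) (k : nat),
      #|K| = k -> (2 <= k)%N ->
      exists f : multiflow G, oblivious (C * ln k%:R) K f.
Proof.
have ln2 : 0 < ln (2 : R) by rewrite ln_gt0 // ltr1n.
(* 288 is the 4 of [approx_minimax] times the 72 of [routing_for_weights]; the other factor absorbs
   the 1 in [1 + ln k], since [ln 2 <= ln k]. *)
have C0 : 0 < 288 * (1 + (ln (2 : R))^-1) by rewrite mulr_gt0 // addr_gt0 // invr_gt0.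
exists (288 * (1 + (ln (2 : R))^-1)) => // G K k Kk k2.
have lnk : ln (2 : R) <= ln k%:R by rewrite ler_ln ?posrE ?ler_nat ?ltr0n // (leq_trans _ k2).
have lnk0 : 0 < ln (k%:R : R) by apply: lt_le_trans lnk.
have a0 : 0 < 72 * (1 + ln (#|K|%:R : R)) by rewrite Kk mulr_gt0 // addr_gt0.
have [w wp|x Qx xa] := approx_minimax a0 (routable0 K) (@routableD _ _ K) (@routableZ _ _ K) _.
  by apply: routing_for_weights wp; rewrite Kk (leq_trans _ k2).
apply: (routable_oblivious _ Qx); first by rewrite mulr_gt0.
move=> e; apply: le_trans (xa e) _; rewrite Kk mulrA -natrM.
rewrite -mulrA ler_wpM2l // mulrDl mul1r addrC lerD2l.
by rewrite mulrC ler_pdivlMr // mul1r.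
Qed.
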